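(* Let $\mathcal{A} = I \otimes A_0 + \sum_{q=1}^{Q_\nu-1} G_q \otimes A_q \in \mathbb{R}^{Q_z N_u \times Q_z N_u}$ be the stochastic Galerkin finite element (SGFE) velocity matrix and let $\widetilde{\mathcal{A}}_{\mathrm{mg}} = I \otimes \widetilde{A}_{\mathrm{mg}}$, where all objects are as defined in the context. Then there is a positive constant $\underline{\delta}$ (not further specified) such that $$\hat{\delta} \le \frac{\mathbf{v}^{\mathrm T}\mathcal{A}\,\mathbf{v}}{\mathbf{v}^{\mathrm T}\widetilde{\mathcal{A}}_{\mathrm{mg}}\,\mathbf{v}} \le \hat{\Delta}, \qquad \forall\, \mathbf{v} \in \mathbb{R}^{Q_z N_u}\setminus\{\mathbf{0}\},$$ with $$\hat{\delta} := \underline{\delta} > 0, \qquad \hat{\Delta} := (\overline{\nu}_0 + \nu_\sigma)\,\Delta, \qquad \nu_\sigma := \sum_{q=1}^{Q_\nu-1} g_q\,\overline{\nu}_q .$$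
   Context: Random input. $D\subset\mathbb{R}^2$ is a bounded domain, $M\in\mathbb{N}$, $k\in\mathbb{N}$, $\sigma_\mu>0$. The functions $\mu_0$ and $\sqrt{\lambda_m}\,\mu_m$ ($m\ge 1$) lie in $L^\infty(D)$, and $(\|\sqrt{\lambda_m}\mu_m\|_{L^\infty(D)})_{m\ge1}\in\ell^1(\mathbb{N})$; here $\mu_0$ is the mean and $(\lambda_m,\mu_m)$ are the Karhunen-Loève eigenpairs of a Gaussian random field. The truncated lognormal viscosity is $\nu_M(x,y)=\exp\big(\mu_0(x)+\sigma_\mu\sum_{m=1}^M\sqrt{\lambda_m}\mu_m(x)y_m\big)$, $y\in\mathbb{R}^M$. Let $\rho(y)=\prod_{m=1}^M (2\pi)^{-1/2}e^{-y_m^2/2}$ and $\langle v\rangle=\int_{\mathbb{R}^M}v(y)\rho(y)\,dy$. Hermite chaos. For a multi-index $(k_1,\dots,k_M)\in\mathbb{N}_0^M$, the associated chaos polynomial is the product of the univariate Hermite polynomials of degrees $k_m$ in $y_m$, orthonormal with respect to the standard Gaussian density. Let $Q_z=\binom{M+k}{k}$ and $Q_\nu=\binom{M+2k}{2k}$. The chaos polynomials $\psi_0,\dots,\psi_{Q_\nu-1}$ enumerate all multi-indices of total degree $\sum_m k_m\le 2k$, in such a way that $\psi_0=1$ and $\psi_0,\dots,\psi_{Q_z-1}$ are those of total degree $\le k$; the latter are the basis of the stochastic Galerkin space $S^k$. For the index $q$ with multi-index $(k_1,\dots,k_M)$ define $$\nu_q(x)=\exp\Big(\mu_0(x)+\tfrac12\sigma_\mu^2\sum_{m=1}^M\lambda_m\mu_m^2(x)\Big)\prod_{m=1}^M\frac{(\sigma_\mu\sqrt{\lambda_m}\mu_m(x))^{k_m}}{\sqrt{k_m!}},\qquad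 \overline{\nu}_q=\|\nu_q\|_{L^\infty(D)}.$$ These are the coefficients of $\nu_M$ in the Hermite chaos basis. Matrices. $I\in\mathbb{R}^{Q_z\times Q_z}$ is the identity. $G_q\in\mathbb{R}^{Q_z\times Q_z}$ has entries $\langle\psi_q\psi_i\psi_j\rangle$, $0\le i,j\le Q_z-1$. For $q\ge1$ with multi-index $(k_1,\dots,k_M)$, $$g_q=\exp\Big(\tfrac{M(k+1)}{2}+\tfrac12\sum_{m=1}^M k_m\Big),$$ which is the constant in the inclusion bound $-g_q\le \mathbf{a}^{\mathrm T}G_q\mathbf{a}/\mathbf{a}^{\mathrm T}\mathbf{a}\le g_q$ for $\mathbf{a}\neq\mathbf{0}$. Let $\{\phi_i\}_{i=1}^{N_u}$ be the basis of the velocity finite element space $V_0^h\subset H_0^1(D)^2$ of continuous piecewise quadratic ($P_2$) vector fields on a regular triangulation of mesh size $h$. Then $A_q\in\mathbb{R}^{N_u\times N_u}$ has entries $\int_D\nu_q\nabla\phi_i\cdot\nabla\phi_j\,dx$, and $A$ is the (unweighted) velocity Laplacian with entries $\int_D\nabla\phi_i\cdot\nabla\phi_j\,dx$. Multigrid preconditioner. $\widetilde{A}_{\mathrm{mg}}\in\mathbb{R}^{N_u\times N_u}$ is the symmetric positive definite matrix representing one multigrid V-cycle. It is spectrally equivalent to $A$: there are constants $\delta,\Delta>0$, independent of $h$, with $\delta\le \mathbf{v}^{\mathrm T}A\mathbf{v}/\mathbf{v}^{\mathrm T}\widetilde{A}_{\mathrm{mg}}\mathbf{v}\le\Delta$ for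 all $\mathbf{v}\in\mathbb{R}^{N_u}\setminus\{\mathbf{0}\}$. Standing assumption. The fully discrete SGFE problem is well-posed; in particular the discrete bilinear form is coercive, i.e. $\mathcal{A}$ is symmetric positive definite.
   Formalization: The inclusion bound -g_q ≤ aᵀG_q a/aᵀa ≤ g_q, stated in the context as known, is assumed for the given M, k and all 1 ≤ q ≤ Q_ν-1: it fails for large k (e.g. M=1, k=200), and there the lemma itself can fail (constant μ_1, Ã_mg=A, σ_μ²λ_1μ_1²≈0.3k). *)

(* Defs.v *)
From mathcomp Require Import all_boot all_order all_algebra.
From mathcomp Require Import all_classical all_reals all_analysis.
From mathcomp Require Export mxtens.

Set Implicit Arguments.
Unset Strict Implicit.
Unset Printing Implicit Defensive.

Import Order.TTheory GRing.Theory Num.Theory.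
Import numFieldNormedType.Exports.

Local Open Scope classical_set_scope.
Local Open Scope ring_scope.

Notation plane R := (R * R)%type.

Definition leb2 (R : realType) :
    {measure set (measurableTypeR R * measurableTypeR R) -> \bar R} :=
  (@lebesgue_measure R \x @lebesgue_measure R)%E.

Definition bounded_domain (R : realType) (D : set (plane R)) : Prop :=
  [/\ D !=set0, open D, connected D & bounded_set D].

(* Functions are defined on the whole plane; only their values on D count. *)
Definition Linfty_norm (R : realType) (D : set (plane R)) (f : plane R -> R) :
    \bar R :=
  ('N[leb2 R]_+oo [EFin \o (f \_ D)])%E.

Definition in_Linfty (R : realType) (D : set (plane R)) (f : plane R -> R) :
    Prop :=
  measurable_fun (D : set (measurableTypeR R * measurableTypeR R)) f /\
  (Linfty_norm D f < +oo)%E.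

Definition int_on (R : realType) (D : set (plane R)) (f : plane R -> R) : R :=
  \int[leb2 R]_(x in D) f x.

Definition in_L2 (R : realType) (D : set (plane R)) (f : plane R -> R) : Prop :=
  measurable_fun (D : set (measurableTypeR R * measurableTypeR R)) f /\
  (leb2 R).-integrable D (fun x => (f x ^+ 2)%:E).

Definition ae_on (R : realType) (D : set (plane R)) (Q : plane R -> Prop) :=
  {ae leb2 R, forall x, D x -> Q x}.

(* Every finite linear combination of values of the field has a normal law,
   point masses being the normal laws of standard deviation 0 (for which
   [normal_prob] takes another convention). *)
Definition gaussian_field (R : realType) (d : measure_display)
    (Omega : measurableType d) (P : probability Omega R)
    (D : set (plane R)) (Z : plane R -> {RV P >-> R}) : Prop :=
  forall (n : nat) (x : 'I_n -> plane R) (a : 'I_n -> R),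
    (forall i, D (x i)) ->
    exists m s : R, forall B : set (measurableTypeR R), measurable B ->
      P ((fun w => \sum_(i < n) a i * Z (x i) w) @^-1` B) =
      (if s == 0 then \d_m B else normal_prob m s B).

Definition in_L2_kernel (R : realType) (D : set (plane R))
    (C : plane R -> plane R -> R) : Prop :=
  let DD := [set z | D z.1 /\ D z.2] in
  measurable_fun (DD : set ((measurableTypeR R * measurableTypeR R) *
                            (measurableTypeR R * measurableTypeR R)))
    (fun z => C z.1 z.2) /\
  (leb2 R \x leb2 R)%E.-integrable DD (fun z => (C z.1 z.2 ^+ 2)%:E).

Definition cov_op (R : realType) (D : set (plane R))
    (C : plane R -> plane R -> R) (f : plane R -> R) (x : plane R) : R :=
  int_on D (fun x' => C x x' * f x').

(* [Z] is a Gaussian random field on D with mean [mu0] and covariance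
   sigma ^ 2 * C, and the (lam m, mu m) are the eigenpairs, orthonormal in
   L^2(D), of the integral operator with kernel C.  The last clause says that
   no part of the operator is missed by the listed eigenpairs; when the
   operator has finite rank, the list is completed by pairs with lam m = 0.
   Index m stands for the pair numbered m + 1 in the 1-based convention. *)
Definition kl_eigenpairs (R : realType) (d : measure_display)
    (Omega : measurableType d) (P : probability Omega R)
    (D : set (plane R)) (Z : plane R -> {RV P >-> R})
    (mu0 : plane R -> R) (sigma : R)
    (lam : nat -> R) (mu : nat -> plane R -> R) : Prop :=
  let C x x' := sigma ^- 2 * fine (covariance P (Z x) (Z x')) in
  [/\ gaussian_field D Z,
      forall x, D x -> 'E_P[Z x]%E = (mu0 x)%:E,
      in_L2_kernel D C &
      [/\ forall m, 0 <= lam m /\ in_L2 D (mu m),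
          forall m n, int_on D (fun x => mu m x * mu n x) = (m == n)%:R,
          forall m, ae_on D (fun x => cov_op D C (mu m) x = lam m * mu m x) &
          forall f, in_L2 D f ->
            (forall m, int_on D (fun x => f x * mu m x) = 0) ->
            ae_on D (fun x => cov_op D C f x = 0)]].

(* The integral over R^M, for the absolutely integrable functions to which it
   is applied, as an iterated Lebesgue integral. *)
Fixpoint int_RM (R : realType) (M : nat) : (M.-tuple R -> R) -> R :=
  match M with
  | 0%N => fun f => f [tuple]
  | M'.+1 => fun f =>
      \int[@lebesgue_measure R]_t
        int_RM (fun y : M'.-tuple R => f [tuple of t :: y])
  end.

Definition gauss_density (R : realType) (M : nat) (y : M.-tuple R) : R :=
  \prod_(m < M) ((Num.sqrt (2 * pi))^-1 * expR (- (tnth y m ^+ 2) / 2)).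

Definition gauss_mean (R : realType) (M : nat) (v : M.-tuple R -> R) : R :=
  int_RM (fun y => v y * gauss_density y).

(* He_n(x) = (-1) ^ n e^(x^2/2) (d/dx)^n e^(-x^2/2). *)
Fixpoint hermite (R : realType) (n : nat) : {poly R} :=
  if n is n'.+1 then 'X * hermite R n' - (hermite R n')^`() else 1.

Definition hermite_on (R : realType) (n : nat) : {poly R} :=
  (Num.sqrt (n`!)%:R)^-1 *: hermite R n.

Notation multi_index M := {ffun 'I_M -> nat}.

Definition total_degree (M : nat) (a : multi_index M) : nat :=
  (\sum_(m < M) a m)%N.

Definition chaos (R : realType) (M : nat) (a : multi_index M)
    (y : M.-tuple R) : R :=
  \prod_(m < M) (hermite_on R (a m)).[tnth y m].

Definition Qz (M k : nat) : nat := 'C(M + k, k).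
Definition Qnu (M k : nat) : nat := 'C(M + 2 * k, 2 * k).

Definition enumerates (M n deg : nat) (alpha : nat -> multi_index M) : Prop :=
  (forall p q, (p < n)%N -> (q < n)%N -> alpha p = alpha q -> p = q) /\
  (forall a, (total_degree a <= deg)%N <-> exists2 q, (q < n)%N & alpha q = a).

(* Only the values of [alpha] below [Qnu M k] matter. *)
Definition chaos_enumeration (M k : nat) (alpha : nat -> multi_index M) :
    Prop :=
  [/\ enumerates (Qz M k) k alpha, enumerates (Qnu M k) (2 * k) alpha &
      total_degree (alpha 0%N) = 0%N].

Definition nu_coef (R : realType) (M : nat) (mu0 : plane R -> R) (sigma : R)
    (lam : nat -> R) (mu : nat -> plane R -> R) (a : multi_index M)
    (x : plane R) : R :=
  expR (mu0 x + 2^-1 * sigma ^+ 2 * \sum_(m < M) lam m * mu m x ^+ 2) *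
  \prod_(m < M)
    ((sigma * Num.sqrt (lam m) * mu m x) ^+ a m / Num.sqrt ((a m)`!)%:R).

Definition g_coef (R : realType) (M k : nat) (a : multi_index M) : R :=
  expR ((M * k.+1)%:R / 2 + (total_degree a)%:R / 2).

Definition G_mx (R : realType) (M k : nat) (alpha : nat -> multi_index M)
    (q : nat) : 'M[R]_(Qz M k) :=
  \matrix_(i < Qz M k, j < Qz M k)
    gauss_mean (fun y => chaos (alpha q) y * chaos (alpha i) y *
                         chaos (alpha j) y).

Definition hull (R : realType) (s : seq (plane R)) : set (plane R) :=
  [set x | exists w : 'I_(size s) -> R,
     [/\ forall i, 0 <= w i, \sum_i w i = 1 & x = \sum_i w i *: s`_i]].

(* A triangle is given by its three vertices. *)
Notation triangle R := (3.-tuple (plane R)).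

Definition nondegenerate (R : realType) (K : triangle R) : Prop :=
  let a := tnth K 0 in let b := tnth K 1 in let c := tnth K 2 in
  (b.1 - a.1) * (c.2 - a.2) - (c.1 - a.1) * (b.2 - a.2) != 0.

Definition dist2 (R : realType) (x y : plane R) : R :=
  Num.sqrt ((x.1 - y.1) ^+ 2 + (x.2 - y.2) ^+ 2).

Definition diam (R : realType) (K : triangle R) : R :=
  \big[Num.max/0]_(i < 3) \big[Num.max/0]_(j < 3) dist2 (tnth K i) (tnth K j).

(* Two distinct triangles meet in the convex hull of their common vertices,
   i.e., not at all, in a common vertex or in a common edge. *)
Definition regular_triangulation (R : realType) (D : set (plane R)) (h : R)
    (T : seq (triangle R)) : Prop :=
  [/\ h = \big[Num.max/0]_(K <- T) diam K,
      forall K, K \in T -> nondegenerate K,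
      closure D = [set x | exists2 K, K \in T & hull K x],
      pairwise (fun K L : triangle R => ~~ perm_eq K L) T &
      forall K L, K \in T -> L \in T -> ~~ perm_eq K L ->
        hull K `&` hull L = hull [seq v <- K | v \in (L : seq _)]].

Definition quadratic_on (R : realType) (K : set (plane R)) (f : plane R -> R) :
    Prop :=
  exists a b c d e g : R, forall x, K x ->
    f x = a + b * x.1 + c * x.2 + d * x.1 ^+ 2 + e * (x.1 * x.2) +
          g * x.2 ^+ 2.

(* Fields are extended by zero outside D; continuity on the plane then includes
   the homogeneous boundary condition. *)
Definition P2_space (R : realType) (D : set (plane R)) (T : seq (triangle R))
    (v : plane R -> plane R) : Prop :=
  [/\ continuous v,
      forall x, ~ D x -> v x = 0 &
      forall K, K \in T ->
        quadratic_on (hull K) (fun x => (v x).1) /\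
        quadratic_on (hull K) (fun x => (v x).2)].

Definition P2_basis (R : realType) (D : set (plane R)) (T : seq (triangle R))
    (Nu : nat) (phi : 'I_Nu -> plane R -> plane R) : Prop :=
  (forall i, P2_space D T (phi i)) /\
  (forall v, P2_space D T v ->
     exists! c : 'rV[R]_Nu, forall x, v x = \sum_(i < Nu) c 0 i *: phi i x).

(* Classical directional derivatives; for elements of [P2_space] they exist off
   the edges, a null set, and are there the weak ones. *)
Definition grad_dot (R : realType) (u v : plane R -> plane R) (x : plane R) :
    R :=
  \sum_(e <- [:: (1, 0); (0, 1)] : seq (plane R))
    ('D_e (fun z => (u z).1 : R) x * 'D_e (fun z => (v z).1 : R) x +
     'D_e (fun z => (u z).2 : R) x * 'D_e (fun z => (v z).2 : R) x).

Definition stiffness_mx (R : realType) (D : set (plane R)) (Nu : nat)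
    (phi : 'I_Nu -> plane R -> plane R) (nu : plane R -> R) : 'M[R]_Nu :=
  \matrix_(i < Nu, j < Nu)
    int_on D (fun x => nu x * grad_dot (phi i) (phi j) x).

Definition laplacian_mx (R : realType) (D : set (plane R)) (Nu : nat)
    (phi : 'I_Nu -> plane R -> plane R) : 'M[R]_Nu :=
  \matrix_(i < Nu, j < Nu) int_on D (grad_dot (phi i) (phi j)).

Definition quad (R : realType) (n : nat) (A : 'M[R]_n) (v : 'cV[R]_n) : R :=
  (v^T *m A *m v) 0 0.

Definition spd (R : realType) (n : nat) (A : 'M[R]_n) : Prop :=
  A^T = A /\ forall v : 'cV[R]_n, v != 0 -> 0 < quad A v.

(* [*t] is the Kronecker product. *)
Definition sgfe_mx (R : realType) (M k Nu : nat) (D : set (plane R))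
    (alpha : nat -> multi_index M) (phi : 'I_Nu -> plane R -> plane R)
    (nu : nat -> plane R -> R) : 'M[R]_(Qz M k * Nu) :=
  1%:M *t stiffness_mx D phi (nu 0%N) +
  \sum_(1 <= q < Qnu M k) G_mx R k alpha q *t stiffness_mx D phi (nu q).

(* Main.v *)
Require Import Defs.
From mathcomp Require Import all_boot all_order all_algebra.
From mathcomp Require Import all_classical all_reals all_analysis.
From mathcomp Require Import mxtens.
From mathcomp Require Import measurable_realfun ess_sup_inf ring lra.

Set Implicit Arguments.
Unset Strict Implicit.
Unset Printing Implicit Defensive.

Import Order.TTheory GRing.Theory Num.Theory.
Import numFieldNormedType.Exports.

Local Open Scope classical_set_scope.
Local Open Scope ring_scope.

(** The lower bound is a statement about matrices: a symmetric positive definite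
    form dominates every other quadratic form on the same finite-dimensional
    space, up to a constant ([spd_dominates]).  Applied to the Galerkin matrix
    and to the preconditioner it gives a positive lower bound for the quotient.

    For the upper bound, write the quadratic form of [G *t A] at v as one
    integral over D.  If the weight of A is nu, and if w_s(x) is the vector,
    indexed by the chaos polynomials, of the s-th first-order derivatives at x
    of the finite element fields with coefficient blocks of v, then

      v^T (G *t A) v = \int_D nu(x) \sum_s w_s(x)^T G w_s(x) dx

    ([quad_tens_weighted_gram]).  The inclusion bound for G is now used
    pointwise, together with |nu| <= nubar almost everywhere, and the integrand
    is at most g nubar \sum_s |w_s(x)|^2.  Its integral is g nubar times the
    quadratic form of [1%:M *t laplacian_mx].  Summing over q, with G = 1 and
    g = 1 for q = 0, gives [sgfe_upper]; spectral equivalence of the Laplacian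
    and the preconditioner, block by block, then brings in the factor Delta.

    The rest is the justification of that integral representation.  Off the
    lines that carry the triangle edges, the derivatives of a piecewise
    quadratic field are piecewise affine, so they are bounded and Borel
    measurable there ([gradient_entry_bounded_measurable]).  On the lines
    nothing is known about them, not even measurability; but the lines have
    measure zero, and the integral ignores a null set whatever the integrand
    does on it ([integral_setD_null]).  The coefficients nu_q are continuous
    functions of finitely many essentially bounded ones, so they have a finite
    essential supremum and are bounded by it off a further null set. *)

(** * Quadratic forms *)

Lemma quadE (R : realType) n (A : 'M[R]_n) (v : 'cV[R]_n) :
  quad A v = \sum_i \sum_j A i j * (v i 0 * v j 0).
Proof.
rewrite /quad !mxE.
under eq_bigr => j _ do rewrite !mxE mulr_suml.
rewrite exchange_big /=; apply: eq_bigr => i _; apply: eq_bigr => j _.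
by rewrite mxE mulrAC mulrC.
Qed.

Lemma quad0v (R : realType) n (A : 'M[R]_n) : quad A 0 = 0.
Proof. by rewrite /quad mulmx0 mxE. Qed.

Lemma quadDl (R : realType) n (A B : 'M[R]_n) (v : 'cV[R]_n) :
  quad (A + B) v = quad A v + quad B v.
Proof. by rewrite /quad mulmxDr mulmxDl mxE. Qed.

Lemma quad_suml (R : realType) n (s : seq nat) (A : nat -> 'M[R]_n)
    (v : 'cV[R]_n) :
  quad (\sum_(q <- s) A q) v = \sum_(q <- s) quad (A q) v.
Proof.
elim: s => [|q s IH]; first by rewrite !big_nil /quad mulmx0 mul0mx mxE.
by rewrite !big_cons quadDl IH.
Qed.

Lemma spd_ge0 (R : realType) n (A : 'M[R]_n) (v : 'cV[R]_n) :
  spd A -> 0 <= quad A v.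
Proof.
move=> [_ A0]; have [->|/A0/ltW//] := eqVneq v 0.
by rewrite quad0v.
Qed.

Lemma spd_unit (R : realType) n (A : 'M[R]_n) : spd A -> A \in unitmx.
Proof.
move=> [As A0]; rewrite -unitmx_tr -row_free_unit -kermx_eq0.
apply/negPn/negP => /rowV0Pn[w /sub_kermxP wA w0].
have : w^T != 0 by apply: contra w0 => /eqP w0; rewrite -[w]trmxK w0 trmx0.
by move=> /A0; rewrite /quad trmxK -As wA mul0mx mxE ltxx.
Qed.

(** Cauchy-Schwarz for the inner product of A: if [A *m w] is the i-th unit
    vector, then v_i is the A-inner product of w and v. *)
Lemma spd_coord_bound (R : realType) n (A : 'M[R]_n) (i : 'I_n) : spd A ->
  exists2 K, 0 <= K & forall v : 'cV[R]_n, v i 0 ^+ 2 <= K * quad A v.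
Proof.
move=> hA; have [As A0] := hA; have Au := spd_unit hA.
have [w Aw] : exists w : 'cV[R]_n, A *m w = delta_mx i 0.
  by exists (invmx A *m delta_mx i 0); rewrite mulmxA mulmxV// mul1mx.
have wA : w^T *m A = delta_mx 0 i by rewrite -As -trmx_mul Aw trmx_delta.
have w0 : w != 0.
  apply/eqP => w0; move: Aw; rewrite w0 mulmx0 => /matrixP/(_ i 0).
  by rewrite !mxE !eqxx => /esym/eqP; rewrite oner_eq0.
set K := w i 0.
have qw : quad A w = K by rewrite /quad wA -rowE mxE.
have K0 : 0 < K by rewrite -qw A0.
exists K; first exact: ltW.
move=> v.
(* Up to scaling, this is v minus its A-orthogonal projection on w. *)
have : 0 <= quad A (K *: v - v i 0 *: w) by exact: spd_ge0.
have -> : quad A (K *: v - v i 0 *: w) = K * (K * quad A v - v i 0 ^+ 2).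
  rewrite /quad.
  have -> : (K *: v - v i 0 *: w)^T = K *: v^T - v i 0 *: w^T.
    by apply/matrixP => a b; rewrite !mxE.
  have vAw : v^T *m A *m w = v^T *m delta_mx i 0 by rewrite -mulmxA Aw.
  rewrite mulmxBl -!scalemxAl wA mulmxBl !mulmxBr -!scalemxAl -!scalemxAr vAw.
  by rewrite -!rowE -colE !mxE -/K; ring.
by rewrite pmulr_rge0// subr_ge0.
Qed.

(** Each product of two coordinates is controlled by the A-form, hence so is
    each term of the B-form. *)
Lemma spd_dominates (R : realType) n (A B : 'M[R]_n) : spd A ->
  exists2 C, 0 < C & forall v : 'cV[R]_n, quad B v <= C * quad A v.
Proof.
move=> hA.
have /choice[K hK] : forall i, exists K, 0 <= K /\
    forall v : 'cV[R]_n, v i 0 ^+ 2 <= K * quad A v.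
  by move=> i; have [K] := spd_coord_bound i hA; exists K.
pose S := \sum_i \sum_j `|B i j| * (K i + K j).
have S0 : 0 <= S.
  apply: sumr_ge0 => i _; apply: sumr_ge0 => j _; apply: mulr_ge0 => //.
  by apply: addr_ge0; have [] := hK i; have [] := hK j.
exists (1 + S) => [|v]; first by rewrite ltr_pwDl.
have qA := spd_ge0 v hA.
rewrite mulrDl mul1r; apply: (@le_trans _ _ (S * quad A v)); last by rewrite lerDr.
rewrite quadE /S mulr_suml; apply: ler_sum => i _.
rewrite mulr_suml; apply: ler_sum => j _.
apply: (le_trans (ler_norm _)); rewrite normrM -mulrA ler_wpM2l//.
have [_ /(_ v) hi] := hK i; have [_ /(_ v) hj] := hK j.
by rewrite mulrDl ler_norml; apply/andP; split; nra.
Qed.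

Lemma quad1E (R : realType) n (v : 'cV[R]_n) :
  quad 1%:M v = \sum_i v i 0 ^+ 2.
Proof.
rewrite quadE; apply: eq_bigr => i _.
rewrite (bigD1 i)//= big1 ?addr0 ?mxE ?eqxx ?mul1r// => j ji.
by rewrite mxE eq_sym (negPf ji) mul0r.
Qed.

Lemma quad1_ge0 (R : realType) n (v : 'cV[R]_n) : 0 <= quad 1%:M v.
Proof. by rewrite quad1E; apply: sumr_ge0 => i _; exact: sqr_ge0. Qed.

Lemma quad1_gt0 (R : realType) n (v : 'cV[R]_n) : v != 0 -> 0 < quad 1%:M v.
Proof.
move=> v0; rewrite lt_neqAle quad1_ge0 andbT eq_sym; apply: contra v0.
rewrite quad1E psumr_eq0 => [/allP v0|i _]; last exact: sqr_ge0.
apply/eqP/matrixP => i j; rewrite ord1 mxE.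
by have := v0 i (mem_index_enum i); rewrite sqrf_eq0 => /eqP.
Qed.

Lemma ratio_bounds_norm (R : realType) n (G : 'M[R]_n) (g : R) :
    (forall a : 'cV[R]_n, a != 0 -> - g <= quad G a / (a^T *m a) 0 0 <= g) ->
  forall a, `|quad G a| <= g * quad 1%:M a.
Proof.
move=> hG a; have [->|a0] := eqVneq a 0; first by rewrite !quad0v normr0 mulr0.
have aa : (a^T *m a) 0 0 = quad 1%:M a by rewrite /quad mulmx1.
have q0 := quad1_gt0 a0.
have := hG a a0; rewrite aa ler_pdivlMr// ler_pdivrMr// => /andP[h1 h2].
by rewrite ler_norml -mulNr h1.
Qed.

(** * Quadratic forms of Kronecker products *)

Definition tens_block (R : realType) m n (v : 'cV[R]_(m * n)) (i : 'I_m) :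
  'cV[R]_n := \col_j v (mxtens_index (i, j)) 0.

Lemma big_mxtens (V : nmodType) m n (F : 'I_(m * n) -> V) :
  \sum_k F k = \sum_i \sum_j F (mxtens_index (i, j)).
Proof.
rewrite pair_bigA /= (reindex (@mxtens_index m n)) /=.
  by apply: eq_bigr => -[].
exists (@mxtens_unindex m n) => k _; first exact: mxtens_indexK.
exact: mxtens_unindexK.
Qed.

Lemma quad_tens (R : realType) m n (G : 'M[R]_m) (A : 'M[R]_n) v :
  quad (G *t A) v = \sum_j \sum_j' A j j' *
    \sum_i \sum_i' G i i' * (tens_block v i j 0 * tens_block v i' j' 0).
Proof.
rewrite quadE.
under eq_bigr => k _ do rewrite big_mxtens.
rewrite big_mxtens exchange_big; apply: eq_bigr => j _ /=.
rewrite [LHS](_ : _ = \sum_i \sum_j' \sum_i' G i i' * A j j' *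
    (tens_block v i j 0 * tens_block v i' j' 0)).
  rewrite exchange_big; apply: eq_bigr => j' _ /=.
  rewrite mulr_sumr; apply: eq_bigr => i _; rewrite mulr_sumr.
  by apply: eq_bigr => i' _; ring.
apply: eq_bigr => i _; rewrite exchange_big; apply: eq_bigr => j' _ /=.
by apply: eq_bigr => i' _; rewrite tensmxE !mxE.
Qed.

Lemma quad_tens1 (R : realType) m n (A : 'M[R]_n) (v : 'cV[R]_(m * n)) :
  quad ((1%:M : 'M[R]_m) *t A) v = \sum_i quad A (tens_block v i).
Proof.
rewrite quad_tens; under [RHS]eq_bigr do rewrite quadE.
rewrite [RHS]exchange_big; apply: eq_bigr => j _ /=.
rewrite [RHS]exchange_big; apply: eq_bigr => j' _ /=.
rewrite -mulr_sumr; congr (_ * _); apply: eq_bigr => i _ /=.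
rewrite (bigD1 i)//= big1 ?addr0 ?mxE ?eqxx ?mul1r// => i' i'i.
by rewrite !mxE eq_sym (negPf i'i) mul0r.
Qed.

Lemma tens_block_eq0 (R : realType) m n (v : 'cV[R]_(m * n)) :
  (forall i, tens_block v i = 0) -> v = 0.
Proof.
move=> v0; apply/matrixP => k l; rewrite ord1 mxE.
rewrite -(mxtens_unindexK k); case: (mxtens_unindex k) => i j.
by have /matrixP/(_ j 0) := v0 i; rewrite !mxE.
Qed.

Lemma spd_tens1_gt0 (R : realType) m n (A : 'M[R]_n) (v : 'cV[R]_(m * n)) :
  spd A -> v != 0 -> 0 < quad ((1%:M : 'M[R]_m) *t A) v.
Proof.
move=> hA v0; rewrite quad_tens1.
have [/existsP[i vi]|] := boolP [exists i, tens_block v i != 0].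
  rewrite (bigD1 i)//= ltr_pwDl//; first by case: hA => _ ->.
  by apply: sumr_ge0 => *; exact: spd_ge0.
rewrite negb_exists => /forallP v0'; case/eqP: v0; apply: tens_block_eq0 => i.
by have /negPn/eqP := v0' i.
Qed.

Lemma quad_tens1_le (R : realType) m n (A B : 'M[R]_n) (Delta : R) :
    (forall w : 'cV[R]_n, quad A w <= Delta * quad B w) ->
  forall v, quad ((1%:M : 'M[R]_m) *t A) v <=
    Delta * quad ((1%:M : 'M[R]_m) *t B) v.
Proof.
by move=> AB v; rewrite !quad_tens1 mulr_sumr; apply: ler_sum => i _; exact: AB.
Qed.

(** * Integrals and null sets *)

Section null_set.
Local Open Scope ereal_scope.
Import HBNNSimple.
Context d (T : measurableType d) (R : realType).
Variable mu : {measure set T -> \bar R}.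

(** The integral of a nonnegative function is a supremum over measurable simple
    functions below it.  Cutting such a simple function off on N changes
    neither its integral nor the inequality, so f itself may be non-measurable;
    the classical derivatives of finite element fields are integrated over
    domains that contain the triangle edges, where this generality matters. *)
Lemma ge0_integral_setD_null (D N : set T) (f : T -> \bar R) :
    measurable N -> mu N = 0 -> (forall x, D x -> 0 <= f x) ->
  \int[mu]_(x in D) f x = \int[mu]_(x in D `\` N) f x.
Proof.
move=> mN N0 f0.
have f0' x : (D `\` N) x -> 0 <= f x by move=> [/f0].
rewrite !ge0_integralE//.
apply/eqP; rewrite eq_le; apply/andP; split; last first.
  apply: ge_ereal_sup => _ [h hf <-]; apply: ereal_sup_ubound; exists h => //= x.
  apply: (le_trans (hf x)); rewrite !patchE.
  have [/set_mem[Dx _]|_] := boolP (x \in D `\` N); first by rewrite mem_set.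
  by case: ifPn => // /set_mem/f0.
apply: ge_ereal_sup => _ [h hf <-].
rewrite -integralT_nnsfun.
rewrite (ge0_negligible_integral mN)//; last 2 first.
- exact/measurable_EFinP.
- by move=> x _; rewrite lee_fin.
rewrite setTD integral_mkcond.
rewrite (_ : _ \_ _ = EFin \o proj_nnsfun h (measurableC mN)); last first.
  apply/funext => x; rewrite patchE /= mindicE.
  by case: ifPn; rewrite ?mulr1 ?mulr0.
rewrite integralT_nnsfun; apply: ereal_sup_ubound.
exists (proj_nnsfun h (measurableC mN)) => //= x; rewrite mindicE patchE.
have hx := hf x; rewrite patchE in hx.
have [xN|xN] := boolP (x \in ~` N).
  rewrite mulr1; apply: (le_trans hx).
  have [/set_mem Dx|Dx] := boolP (x \in D).
    by rewrite mem_set//; split => //; exact: set_mem.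
  by rewrite memNset// => -[Dx' _]; move: Dx; rewrite mem_set.
by rewrite mulr0; case: ifPn => // /set_mem/f0'.
Qed.

Lemma integral_setD_null (D N : set T) (f : T -> \bar R) :
  measurable N -> mu N = 0 ->
  \int[mu]_(x in D) f x = \int[mu]_(x in D `\` N) f x.
Proof.
move=> mN N0; rewrite [LHS]integralE [RHS]integralE.
by congr (_ - _); exact: ge0_integral_setD_null.
Qed.

End null_set.

Lemma Rintegral_setD_null d (T : measurableType d) (R : realType)
    (mu : {measure set T -> \bar R}) (D N : set T) (f : T -> R) :
  measurable N -> mu N = 0%E ->
  \int[mu]_(x in D) f x = \int[mu]_(x in D `\` N) f x.
Proof. by move=> mN N0; rewrite /Rintegral (integral_setD_null D _ mN). Qed.

(** * Bounded measurable functions *)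

(** On a set of finite measure these functions are integrable, and unlike the
    integrable ones they form an algebra; all integrands of the proof are built
    from them by sums and products. *)
Definition bounded_measurable d (T : measurableType d) (R : realType)
    (E : set T) (f : T -> R) : Prop :=
  measurable_fun E f /\ exists C, forall x, E x -> `|f x| <= C.

Section bounded_measurable.
Context d (T : measurableType d) (R : realType) (E : set T).
Implicit Types f g : T -> R.
Local Notation BM := (bounded_measurable E).

Lemma bounded_measurable_cst (c : R) : BM (fun=> c).
Proof. by split; [exact: measurable_cst|exists `|c|]. Qed.

Lemma bounded_measurableD f g : BM f -> BM g -> BM (fun x => f x + g x).
Proof.
move=> [mf [C Cf]] [mg [C' Cg]]; split; first exact: measurable_funD.
by exists (C + C') => x Ex; rewrite (le_trans (ler_normD _ _))// lerD ?Cf ?Cg.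
Qed.

Lemma bounded_measurableM f g : BM f -> BM g -> BM (fun x => f x * g x).
Proof.
move=> [mf [C Cf]] [mg [C' Cg]]; split; first exact: measurable_funM.
by exists (C * C') => x Ex; rewrite normrM ler_pM ?Cf ?Cg.
Qed.

Lemma bounded_measurableX f n : BM f -> BM (fun x => f x ^+ n).
Proof.
move=> hf; elim: n => [|n IH]; first exact: bounded_measurable_cst.
by under eq_fun do rewrite exprS; exact: bounded_measurableM.
Qed.

Lemma bounded_measurable_sum (I : Type) (s : seq I) (F : I -> T -> R) :
  (forall i, BM (F i)) -> BM (fun x => \sum_(i <- s) F i x).
Proof.
move=> hF; elim: s => [|i s IH].
  by under eq_fun do rewrite big_nil; exact: bounded_measurable_cst.
by under eq_fun do rewrite big_cons; exact: bounded_measurableD.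
Qed.

Lemma bounded_measurable_prod (I : Type) (s : seq I) (F : I -> T -> R) :
  (forall i, BM (F i)) -> BM (fun x => \prod_(i <- s) F i x).
Proof.
move=> hF; elim: s => [|i s IH].
  by under eq_fun do rewrite big_nil; exact: bounded_measurable_cst.
by under eq_fun do rewrite big_cons; exact: bounded_measurableM.
Qed.

Lemma bounded_measurable_expR f : BM f -> BM (fun x => expR (f x)).
Proof.
move=> [mf [C Cf]]; split; first exact: (measurableT_comp (@measurable_expR R)).
exists (expR C) => x Ex; rewrite ger0_norm ?expR_ge0// ler_expR.
exact: le_trans (ler_norm _) (Cf x Ex).
Qed.

Variable mu : {measure set T -> \bar R}.
Hypotheses (mE : measurable E) (Efin : (mu E < +oo)%E).

Lemma bounded_measurable_integrable f : BM f -> mu.-integrable E (EFin \o f).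
Proof.
move=> [mf [C Cf]]; apply: measurable_bounded_integrable => //.
exists C; split; first exact: num_real.
by move=> x Cx y Ey /=; rewrite (le_trans (Cf _ Ey))// ltW.
Qed.

Lemma Rintegral_sum (I : Type) (s : seq I) (F : I -> T -> R) :
    (forall i, BM (F i)) ->
  \int[mu]_(x in E) (\sum_(i <- s) F i x) = \sum_(i <- s) \int[mu]_(x in E) F i x.
Proof.
move=> hF; elim: s => [|i s IH].
  rewrite big_nil; under eq_Rintegral do rewrite big_nil.
  by rewrite Rintegral_cst// mul0r.
rewrite big_cons -IH; under eq_Rintegral do rewrite big_cons.
by rewrite RintegralD//; apply: bounded_measurable_integrable => //;
  exact: bounded_measurable_sum.
Qed.

End bounded_measurable.

Lemma bounded_measurableS d (T : measurableType d) (R : realType) (E F : set T)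
    (f : T -> R) :
  measurable F -> E `<=` F -> bounded_measurable F f -> bounded_measurable E f.
Proof.
move=> mF EF [mf [C Cf]]; split; first exact: measurable_funS mf.
by exists C => x /EF/Cf.
Qed.

(** The pieces need not be disjoint: the induction removes the first piece from
    E before it treats the others. *)
Lemma bounded_measurable_cover d (T : measurableType d) (R : realType)
    (I : eqType) (s : seq I) (O : I -> set T) (E : set T) (f : T -> R) :
    measurable E -> (forall i, measurable (O i)) ->
    (forall x, E x -> exists2 i, i \in s & O i x) ->
    (forall i, i \in s -> bounded_measurable (E `&` O i) f) ->
  bounded_measurable E f.
Proof.
move=> mE mO; elim: s E mE => [|i s IH] E mE cov hf.
  have -> : E = set0 by apply/seteqP; split => // x /cov[].
  by split; [exact: measurable_fun_set0|exists 0].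
have [mi [Ci hCi]] : bounded_measurable (E `&` O i) f.
  by apply: hf; rewrite mem_head.
have [ms [Cs hCs]] : bounded_measurable (E `\` O i) f.
  apply: IH => [|x [/cov[j]]|j js]; first exact: measurableD.
    by rewrite inE => /predU1P[->|js] Oj nOj //; exists j.
  have : bounded_measurable (E `&` O j) f by apply: hf; rewrite inE js orbT.
  by apply: bounded_measurableS; [exact: measurableI|move=> x [[]]].
have EE : E = (E `&` O i) `|` (E `\` O i) by rewrite setUIDK.
split.
  rewrite EE; apply/measurable_funU => //; first exact: measurableI.
  exact: measurableD.
exists (Num.max Ci Cs) => x Ex; rewrite le_max.
by have [Ox|Ox] := pselect (O i x); [rewrite hCi|rewrite hCs// orbT].
Qed.

(** * Kronecker products with weighted Gram matrices *)

Lemma exchange_big4 (V : nmodType) (I J : finType) (F : I -> I -> J -> J -> V) :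
  \sum_i \sum_i' \sum_j \sum_j' F i i' j j' =
  \sum_j \sum_j' \sum_i \sum_i' F i i' j j'.
Proof.
under eq_bigr do rewrite exchange_big /=.
rewrite exchange_big /=; apply: eq_bigr => j _.
by under eq_bigr do rewrite exchange_big /=; rewrite exchange_big.
Qed.

Section weighted_gram.
Context d (T : measurableType d) (R : realType).
Variables (mu : {measure set T -> \bar R}) (E : set T).
Hypotheses (mE : measurable E) (Efin : (mu E < +oo)%E).
Variables (N : nat) (I : Type) (r : seq I) (p : 'I_N -> I -> T -> R).
Hypothesis hp : forall j s, bounded_measurable E (p j s).

(** The stiffness matrix for the weight nu, when [p j] lists the first-order
    derivatives of the j-th basis field. *)
Definition weighted_gram (nu : T -> R) : 'M[R]_N := \matrix_(j, j')
  \int[mu]_(x in E) (nu x * \sum_(s <- r) p j s x * p j' s x).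

(** The s-th derivatives of the m fields whose coefficient vectors are the
    blocks of v, collected into one vector at each point. *)
Let field m (v : 'cV[R]_(m * N)) (s : I) (x : T) : 'cV[R]_m :=
  \col_i \sum_j tens_block v i j 0 * p j s x.

Let hfield m (G : 'M[R]_m) v nu : bounded_measurable E nu ->
  bounded_measurable E (fun x => nu x * \sum_(s <- r) quad G (field v s x)).
Proof.
move=> hnu; apply: bounded_measurableM => //; apply: bounded_measurable_sum => s.
under eq_fun do rewrite quadE.
apply: bounded_measurable_sum => i; apply: bounded_measurable_sum => j.
apply: bounded_measurableM; first exact: bounded_measurable_cst.
under eq_fun do rewrite !mxE.
apply: bounded_measurableM; apply: bounded_measurable_sum => l;
  by apply: bounded_measurableM => //; exact: bounded_measurable_cst.
Qed.

(** The sums over the basis of the Galerkin product space can be carried out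
    under the integral, before the sums over the derivatives. *)
Lemma quad_tens_weighted_gram m (G : 'M[R]_m) (v : 'cV[R]_(m * N)) nu :
    bounded_measurable E nu ->
  quad (G *t weighted_gram nu) v =
  \int[mu]_(x in E) (nu x * \sum_(s <- r) quad G (field v s x)).
Proof.
move=> hnu; rewrite quad_tens.
pose c j j' := \sum_i \sum_i' G i i' *
  (tens_block v i j 0 * tens_block v i' j' 0).
have hf j j' : bounded_measurable E
    (fun x => nu x * \sum_(s <- r) p j s x * p j' s x).
  apply: bounded_measurableM => //; apply: bounded_measurable_sum => s.
  exact: bounded_measurableM.
have hc j j' := bounded_measurableM (hf j j') (bounded_measurable_cst E (c j j')).
transitivity (\int[mu]_(x in E) \sum_j \sum_j'
    (nu x * \sum_(s <- r) p j s x * p j' s x) * c j j').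
  rewrite Rintegral_sum//; last by move=> j; exact: bounded_measurable_sum.
  apply: eq_bigr => j _; rewrite Rintegral_sum//; apply: eq_bigr => j' _.
  by rewrite mxE RintegralZr//; exact: bounded_measurable_integrable.
apply: eq_Rintegral => x _.
transitivity (nu x * \sum_j \sum_j' \sum_(s <- r) p j s x * p j' s x * c j j').
  rewrite mulr_sumr; apply: eq_bigr => j _; rewrite mulr_sumr.
  by apply: eq_bigr => j' _; rewrite -mulrA mulr_suml.
congr (_ * _); under eq_bigr do rewrite exchange_big /=.
rewrite exchange_big /=; apply: eq_bigr => s _; rewrite quadE.
transitivity (\sum_i \sum_i' \sum_j \sum_j' G i i' *
  ((tens_block v i j 0 * p j s x) * (tens_block v i' j' 0 * p j' s x))).
  rewrite exchange_big4; apply: eq_bigr => j _; apply: eq_bigr => j' _.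
  rewrite /c mulr_sumr; apply: eq_bigr => i _.
  by rewrite mulr_sumr; apply: eq_bigr => i' _; ring.
apply: eq_bigr => i _; apply: eq_bigr => i' _.
rewrite !mxE big_distrlr /= mulr_sumr.
by apply: eq_bigr => j _; rewrite mulr_sumr.
Qed.

(** Both factors of the integrand are estimated pointwise: the weight by b, the
    form of G by g times the Euclidean form. *)
Lemma quad_tens_weighted_gram_le m (G : 'M[R]_m) (v : 'cV[R]_(m * N)) nu g b :
    bounded_measurable E nu -> 0 <= b -> (forall x, E x -> `|nu x| <= b) ->
    (forall a, `|quad G a| <= g * quad 1%:M a) ->
  quad (G *t weighted_gram nu) v <=
  g * b * quad (1%:M *t weighted_gram (fun=> 1)) v.
Proof.
move=> hnu b0 nub hG; have h1 := bounded_measurable_cst E (1 : R).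
have i1 := bounded_measurable_integrable mE Efin (hfield 1%:M v h1).
rewrite !quad_tens_weighted_gram// -RintegralZl//.
apply: le_Rintegral => //.
- exact: bounded_measurable_integrable (hfield _ _ _).
- apply: bounded_measurable_integrable => //.
  by apply: bounded_measurableM; [exact: bounded_measurable_cst|exact: hfield].
move=> x Ex; rewrite mul1r; apply: le_trans (ler_norm _) _; rewrite normrM.
rewrite [g * b]mulrC -mulrA; apply: ler_pM => //; first exact: nub.
apply: (le_trans (ler_norm_sum _ _ _)); rewrite mulr_sumr.
by apply: ler_sum => s _; exact: hG.
Qed.

End weighted_gram.

(** * Lebesgue measure in the plane *)

Notation mplane R := (measurableTypeR R * measurableTypeR R)%type.

Lemma measurable_coord1 (R : realType) (E : set (mplane R)) :
  measurable_fun E (fun x : mplane R => x.1 : R).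
Proof. exact: measurable_funS measurable_fst. Qed.

Lemma measurable_coord2 (R : realType) (E : set (mplane R)) :
  measurable_fun E (fun x : mplane R => x.2 : R).
Proof. exact: measurable_funS measurable_snd. Qed.

Lemma measurable_affine (R : realType) (E : set (mplane R)) (a b c : R) :
  measurable_fun E (fun x : mplane R => a * x.1 + b * x.2 + c : R).
Proof.
apply: measurable_funD; last exact: measurable_cst.
apply: measurable_funD; apply: measurable_funM; try exact: measurable_cst.
- exact: measurable_coord1.
- exact: measurable_coord2.
Qed.

Definition line (R : realType) (a b c : R) : set (mplane R) :=
  [set x | a * x.1 + b * x.2 + c = 0].

Lemma measurable_line (R : realType) (a b c : R) : measurable (line a b c).
Proof.
have := @measurable_affine R setT a b c measurableT [set 0] (measurable_set1 _).
by rewrite setTI.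
Qed.

Lemma line_null (R : realType) (a b c : R) : (a != 0) || (b != 0) ->
  leb2 R (line a b c) = 0%E.
Proof.
have [->|b0 _] := eqVneq b 0.
  rewrite orbF => a0.
  have -> : line a 0 c = [set - c / a] `*` setT.
    apply/seteqP; split => -[x y]; rewrite /line /=.
      by move=> e; split=> //; apply: (mulfI a0); rewrite mulrCA divff// mulr1; lra.
    by move=> [-> _]; rewrite mulrCA divff//; lra.
  rewrite [LHS]product_measure1E//.
  by rewrite [X in (X * _)%E]lebesgue_measure_set1 mul0e.
rewrite /leb2 /product_measure1.
apply: integral0_eq => x _ /=.
have -> : xsection (line a b c) x = [set (- c - a * x) / b].
  apply/seteqP; split => y; rewrite /xsection /= inE /line /=.
    by move=> e; apply: (mulfI b0); rewrite mulrCA divff// mulr1; lra.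
  by move=> ->; rewrite mulrCA divff//; lra.
exact: lebesgue_measure_set1.
Qed.

(** The measurable sets of the plane are generated by rectangles, not by open
    sets; an open set is the union of the countably many squares with rational
    centre and radius 1/(n+1) that it contains. *)
Lemma open_measurable_plane (R : realType) (D : set (plane R)) : open D ->
  measurable (D : set (mplane R)).
Proof.
move=> oD.
pose box (q : rat * rat * nat) : set (mplane R) :=
  ball (ratr q.1.1 : R) (q.2.+1%:R^-1) `*` ball (ratr q.1.2 : R) (q.2.+1%:R^-1).
have -> : D = \bigcup_(q in [set q | box q `<=` D]) box q.
  apply/seteqP; split => [x Dx|x [q /= qD]]; last exact: qD.
  have /nbhs_ballP[e /= e0 eD] : nbhs x D.
    by apply: open_nbhs_nbhs; split.
  have e20 : 0 < e / 2 by rewrite divr_gt0.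
  have [n _ /(_ n (leqnn n)) /= ne] := near_infty_natSinv_lt (PosNum e20).
  have ee : n.+1%:R^-1 + n.+1%:R^-1 <= e by rewrite [leRHS]splitr lerD// ltW.
  have rat_near (y : R) : exists q : rat, ball y (n.+1%:R^-1) (ratr q : R).
    have [|q] := @rat_in_itvoo R y (y + n.+1%:R^-1); first by rewrite ltrDl invr_gt0.
    rewrite in_itv => /andP[yq qy]; exists q.
    by rewrite /ball /= distrC ger0_norm ?subr_ge0 ?ltW// ltrBlDl.
  have [q1 h1] := rat_near x.1; have [q2 h2] := rat_near x.2.
  exists (q1, q2, n); last by split; apply: ball_sym.
  move=> y [/= y1 y2]; apply: eD; split => /=.
    apply: (@le_ball _ _ _ (n.+1%:R^-1 + n.+1%:R^-1)); first exact: ee.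
    exact: ball_triangle y1.
  apply: (@le_ball _ _ _ (n.+1%:R^-1 + n.+1%:R^-1)); first exact: ee.
  exact: ball_triangle y2.
rewrite bigcup_mkcond; apply: countable_bigcupT_measurable => // q.
by case: ifP => // _; apply: measurableX; exact: measurable_ball.
Qed.

Lemma bounded_finite_measure (R : realType) (D : set (plane R)) :
  bounded_set D -> measurable (D : set (mplane R)) -> (leb2 R D < +oo)%E.
Proof.
move=> [M [Mr hM]] mD.
pose B := `[- (`|M| + 1), `|M| + 1]%classic : set (measurableTypeR R).
have DB : D `<=` B `*` B.
  move=> x Dx; have := hM (`|M| + 1) _ x Dx.
  rewrite /= prod_normE ge_max => /(_ _)/andP[].
    by rewrite (le_lt_trans (ler_norm _))// ltrDl.
  by rewrite !ler_norml => h1 h2; split; rewrite /B /= in_itv.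
have mB : measurable B by exact: measurable_itv.
have Bfin : (lebesgue_measure B < +oo)%E.
  by rewrite /B lebesgue_measure_itv/=; case: ifPn => // _; exact: ltry.
apply: (@le_lt_trans _ _ (leb2 R (B `*` B))).
  by apply: le_measure; rewrite ?inE//; exact: measurableX.
rewrite [ltLHS]product_measure1E// lte_mul_pinfty//.
by rewrite ge0_fin_numE.
Qed.

(** * Triangles *)

Definition orient (R : realType) (a b x : plane R) : R :=
  (b.1 - a.1) * (x.2 - a.2) - (x.1 - a.1) * (b.2 - a.2).

Lemma orient_line (R : realType) (a b : plane R) :
  [set x | orient a b x = 0] =
  line (- (b.2 - a.2)) (b.1 - a.1) (a.1 * (b.2 - a.2) - (b.1 - a.1) * a.2).
Proof.
by apply/seteqP; split => x; rewrite /line /orient /= => e; rewrite -[RHS]e; ring.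
Qed.

Lemma measurable_orient (R : realType) (a b : plane R) :
  measurable_fun setT (orient a b : mplane R -> R).
Proof.
rewrite (_ : orient a b = fun x => - (b.2 - a.2) * x.1 + (b.1 - a.1) * x.2 +
    (a.1 * (b.2 - a.2) - (b.1 - a.1) * a.2)).
  exact: measurable_affine.
by apply/funext => x; rewrite /orient; ring.
Qed.

Lemma continuous_orient (R : realType) (a b : plane R) :
  continuous (orient a b : plane R -> R).
Proof.
move=> x; apply: cvgB; apply: cvgM; try exact: cvg_cst.
  by apply: cvgB; [exact: cvg_snd|exact: cvg_cst].
by apply: cvgB; [exact: cvg_fst|exact: cvg_cst].
Qed.

(** The full lines through the edges, rather than the edges: they are null sets
    all the same, and leaving them out makes the signed areas nonzero. *)
Definition edge_lines (R : realType) (K : triangle R) : set (mplane R) :=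
  let a := tnth K 0 in let b := tnth K 1 in let c := tnth K 2 in
  [set x | orient a b x = 0] `|` [set x | orient b c x = 0] `|`
  [set x | orient c a x = 0].

(** The factor [orient a b c] makes the conditions independent of the order in
    which the vertices are listed. *)
Definition tri_interior (R : realType) (K : triangle R) : set (mplane R) :=
  let a := tnth K 0 in let b := tnth K 1 in let c := tnth K 2 in
  [set x | 0 < orient a b c * orient a b x] `&`
  [set x | 0 < orient a b c * orient b c x] `&`
  [set x | 0 < orient a b c * orient c a x].

Lemma measurable_edge_lines (R : realType) (K : triangle R) :
  measurable (edge_lines K).
Proof.
by rewrite /edge_lines /= !orient_line; apply: measurableU;
  [apply: measurableU|]; exact: measurable_line.
Qed.

Lemma edge_lines_null (R : realType) (K : triangle R) : Defs.nondegenerate K ->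
  leb2 R (edge_lines K) = 0%E.
Proof.
rewrite /Defs.nondegenerate /edge_lines /=.
set a := tnth K 0; set b := tnth K 1; set c := tnth K 2 => nd.
rewrite !orient_line.
have e1 : (- (b.2 - a.2) != 0) || (b.1 - a.1 != 0).
  rewrite -negb_and; apply: contra nd => /andP[/eqP h2 /eqP h1]; apply/eqP.
  have -> : b.1 = a.1 by lra. have -> : b.2 = a.2 by lra. by ring.
have e2 : (- (c.2 - b.2) != 0) || (c.1 - b.1 != 0).
  rewrite -negb_and; apply: contra nd => /andP[/eqP h2 /eqP h1]; apply/eqP.
  have -> : c.1 = b.1 by lra. have -> : c.2 = b.2 by lra. by ring.
have e3 : (- (a.2 - c.2) != 0) || (a.1 - c.1 != 0).
  rewrite -negb_and; apply: contra nd => /andP[/eqP h2 /eqP h1]; apply/eqP.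
  have -> : c.1 = a.1 by lra. have -> : c.2 = a.2 by lra. by ring.
apply: null_set_setU; [|exact: measurable_line| |exact: line_null].
- by apply: measurableU; exact: measurable_line.
- apply: null_set_setU; [exact: measurable_line|exact: measurable_line| |].
    exact: line_null.
  exact: line_null.
Qed.

Lemma measurable_tri_interior (R : realType) (K : triangle R) :
  measurable (tri_interior K).
Proof.
have h (u : R) (a b : plane R) :
    measurable ([set x | 0 < u * orient a b x] : set (mplane R)).
  have mf : measurable_fun setT (fun x : mplane R => u * orient a b x : R).
    by apply: measurable_funM; [exact: measurable_cst|exact: measurable_orient].
  have := mf measurableT `]0, +oo[%classic (measurable_itv _).
  rewrite setTI; congr measurable; apply/seteqP.
  by split => x /=; rewrite in_itv /= andbT.
by apply: measurableI; [apply: measurableI|]; exact: h.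
Qed.

Lemma open_tri_interior (R : realType) (K : triangle R) :
  open (tri_interior K : set (plane R)).
Proof.
have h (u : R) (a b : plane R) : open [set x : plane R | 0 < u * orient a b x].
  apply: (@open_comp _ _ (fun x : plane R => u * orient a b x) [set y | 0 < y]).
    by move=> x _; apply: cvgM; [exact: cvg_cst|exact: continuous_orient].
  exact: open_gt.
by apply: openI => //; exact: openI.
Qed.

Lemma hull_tripleP (R : realType) (a b c x : plane R) :
  hull [:: a; b; c] x <-> exists u v w : R,
    [/\ [/\ 0 <= u, 0 <= v & 0 <= w], u + v + w = 1,
        x.1 = u * a.1 + v * b.1 + w * c.1 & x.2 = u * a.2 + v * b.2 + w * c.2].
Proof.
split=> [[w [w0 w1 ->]]|[u [v [w [[u0 v0 w0] uvw x1 x2]]]]].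
  exists (w ord0), (w (lift ord0 ord0)), (w (lift ord0 (lift ord0 ord0))).
  split => //.
  - by rewrite -w1 !big_ord_recl big_ord0 addr0 addrA.
  - by rewrite !big_ord_recl big_ord0 addr0 addrA.
  - by rewrite !big_ord_recl big_ord0 addr0 addrA.
exists (fun i : 'I_3 => [:: u; v; w]`_i); split.
- by move=> [[|[|[|]]]].
- by rewrite !big_ord_recl big_ord0 /= addr0 addrA.
- rewrite !big_ord_recl big_ord0 /= addr0 addrA.
  by case: x x1 x2 => x1 x2 /= -> ->.
Qed.

Lemma triangleE (R : realType) (K : triangle R) :
  (K : seq _) = [:: tnth K 0; tnth K 1; tnth K 2].
Proof.
by case/tupleP: K => a K; case/tupleP: K => b K; case/tupleP: K => c K; rewrite tuple0.
Qed.

(** Twice the signed areas of the triangles spanned by x and the edges are the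
    barycentric coordinates of x times [orient a b c]. *)
Lemma hull_interior (R : realType) (K : triangle R) (x : plane R) :
  Defs.nondegenerate K -> hull K x -> ~ edge_lines K x -> tri_interior K x.
Proof.
rewrite triangleE /Defs.nondegenerate /edge_lines /tri_interior /=.
set a := tnth K 0; set b := tnth K 1; set c := tnth K 2 => nd.
move=> /hull_tripleP[u [v [w [[u0 v0 w0] uvw x1 x2]]]] nx.
have nd2 : 0 < orient a b c ^+ 2 by rewrite lt_neqAle eq_sym sqrf_eq0 nd sqr_ge0.
have ew : orient a b x = w * orient a b c.
  by rewrite /orient x1 x2 (_ : u = 1 - v - w); [ring|lra].
have eu : orient b c x = u * orient a b c.
  by rewrite /orient x1 x2 (_ : w = 1 - v - u); [ring|lra].
have ev : orient c a x = v * orient a b c.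
  by rewrite /orient x1 x2 (_ : u = 1 - v - w); [ring|lra].
have pos t : 0 <= t -> t * orient a b c <> 0 ->
    0 < orient a b c * (t * orient a b c).
  move=> t0 tn; rewrite mulrCA -expr2 mulr_gt0// lt_neqAle t0 andbT eq_sym.
  by apply/eqP => t00; apply: tn; rewrite t00 mul0r.
split; [split|]; rewrite /= ?ew ?eu ?ev; apply: pos => // e; apply: nx.
- by left; left; rewrite /= ew.
- by left; right; rewrite /= eu.
- by right; rewrite /= ev.
Qed.

Lemma tri_interior_hull (R : realType) (K : triangle R) :
  tri_interior K `<=` hull K.
Proof.
rewrite triangleE /tri_interior => x /=.
set a := tnth K 0; set b := tnth K 1; set c := tnth K 2.
move=> [[/= hw hu] hv]; apply/hull_tripleP.
have nd : orient a b c != 0.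
  by apply: contraTneq hw => ->; rewrite mul0r ltxx.
have pos t : 0 < orient a b c * t -> 0 <= t / orient a b c.
  move=> t0; rewrite (_ : t / _ = (orient a b c * t) / orient a b c ^+ 2).
    by apply: divr_ge0; [exact: ltW|exact: sqr_ge0].
  by field.
exists (orient b c x / orient a b c), (orient c a x / orient a b c),
  (orient a b x / orient a b c).
split; first by split; apply: pos.
all: move: nd; rewrite /orient => nd; field; exact: nd.
Qed.

Lemma all_edge_lines_null (R : realType) (T : seq (triangle R)) :
    (forall K, K \in T -> Defs.nondegenerate K) ->
  exists N : set (mplane R), [/\ measurable N, leb2 R N = 0%E &
    forall x K, K \in T -> ~ N x -> ~ edge_lines K x].
Proof.
elim: T => [|K T IH] nd; first by exists set0; split; rewrite ?measure0.
have [|N [mN N0 hN]] := IH; first by move=> L LT; apply: nd; rewrite inE LT orbT.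
have mK := measurable_edge_lines K.
have K0 : leb2 R (edge_lines K) = 0%E.
  by apply: edge_lines_null; apply: nd; rewrite mem_head.
exists (edge_lines K `|` N); split; first exact: measurableU.
  exact: null_set_setU.
move=> x L; rewrite inE => /predU1P[->|LT] Nx; first by move=> Kx; apply: Nx; left.
by apply: hN => // Nx'; apply: Nx; right.
Qed.

(** * Derivatives of piecewise quadratic functions *)

(** The difference quotient along v is the claimed value plus h times the
    quadratic part of the polynomial at v. *)
Lemma derive_quadratic (R : realType) (a b c d e g : R) (v x : plane R) :
  'D_v (fun y : plane R => a + b * y.1 + c * y.2 + d * y.1 ^+ 2 +
         e * (y.1 * y.2) + g * y.2 ^+ 2 : R) x =
  (2 * d * v.1 + e * v.2) * x.1 + (e * v.1 + 2 * g * v.2) * x.2 +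
  (b * v.1 + c * v.2).
Proof.
set L := RHS.
pose q := d * v.1 ^+ 2 + e * (v.1 * v.2) + g * v.2 ^+ 2.
apply/cvg_lim => //.
have : (fun h : R => L + h * q) @ 0^' --> L.
  apply: cvg_trans; last first.
    apply: (_ : (fun h : R => L + h * q) @ 0 --> L).
    rewrite -[X in _ --> X](_ : L + 0 * q = L); last by rewrite mul0r addr0.
    by apply: cvgD; [exact: cvg_cst|apply: cvgM; [exact: cvg_id|exact: cvg_cst]].
  by apply: cvg_app; exact: nbhs_dnbhs.
apply: cvg_trans; apply: near_eq_cvg; near=> h.
have h0 : h != 0 by near: h; exact: nbhs_dnbhs_neq.
by rewrite /L /q /= /GRing.scale /=; field.
Unshelve. all: by end_near. Qed.

(** The interior is open, so f agrees with one polynomial near each of its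
    points, whatever f does outside the triangle. *)
Lemma derive_on_piece (R : realType) (K : triangle R) (f : plane R -> R)
    (v : plane R) : quadratic_on (hull K) f ->
  exists p q r : R, forall x, tri_interior K x ->
    'D_v f x = p * x.1 + q * x.2 + r.
Proof.
move=> [a [b [c [d [e [g fE]]]]]].
exists (2 * d * v.1 + e * v.2), (e * v.1 + 2 * g * v.2), (b * v.1 + c * v.2).
move=> x Kx; rewrite -(derive_quadratic a); apply: near_eq_derive.
have : nbhs x (tri_interior K : set (plane R)).
  by apply: open_nbhs_nbhs; split => //; exact: open_tri_interior.
by apply: filterS => y /tri_interior_hull/fE.
Qed.

Lemma bounded_measurable_derive (R : realType) (D : set (plane R))
    (T : seq (triangle R)) (E : set (mplane R)) (f : plane R -> R) (v : plane R) :
    bounded_set D -> measurable E -> E `<=` D ->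
    (forall x, E x -> exists2 K, K \in T & tri_interior K x) ->
    (forall K, K \in T -> quadratic_on (hull K) f) ->
  bounded_measurable E ('D_v f : mplane R -> R).
Proof.
move=> [B [Br hB]] mE ED cov hf.
have [B1 hB1] : exists B1, forall x, E x -> `|x.1| <= B1 /\ `|x.2| <= B1.
  exists (`|B| + 1) => x /ED Dx; have := hB (`|B| + 1) _ x Dx.
  rewrite /= prod_normE ge_max => /(_ _)/andP[] //.
  by rewrite (le_lt_trans (ler_norm _))// ltrDl.
apply: (bounded_measurable_cover mE (@measurable_tri_interior R) cov) => K KT.
have [p [q [r pqr]]] := derive_on_piece v (hf K KT).
have mEK := measurableI _ _ mE (measurable_tri_interior K).
split.
  apply: (eq_measurable_fun (fun x : mplane R => p * x.1 + q * x.2 + r)).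
    by move=> x; rewrite inE => -[_ /pqr].
  exact: measurable_affine.
exists (`|p| * B1 + `|q| * B1 + `|r|) => x [Ex /pqr ->].
have [h1 h2] := hB1 x Ex.
rewrite (le_trans (ler_normD _ _))// lerD// (le_trans (ler_normD _ _))//.
by rewrite !normrM lerD// ler_wpM2l.
Qed.

(** * Essential bounds for the coefficients *)

Section essential_bound.
Context (R : realType) (D : set (plane R)).
Implicit Types f : plane R -> R.

Lemma Linfty_norm_ge0 f : (0 <= Linfty_norm D f)%E.
Proof. exact: Lnorm_ge0. Qed.

(** The infimum that defines the essential supremum is attained. *)
Lemma Linfty_norm_bound f : (Linfty_norm D f < +oo)%E ->
  exists N : set (mplane R), [/\ measurable N, leb2 R N = 0%E &
    forall x, (D `\` N) x -> `|f x| <= fine (Linfty_norm D f)].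
Proof.
move=> fy; have ffin : Linfty_norm D f \is a fin_num.
  by rewrite ge0_fin_numE// Linfty_norm_ge0.
(* The norm is 0 by convention when the whole space is null; the whole plane
   then serves as the exceptional set. *)
have [T0|T0] := pselect (0 < leb2 R setT)%E; last first.
  exists setT; split => //; last by move=> x [_ /(_ I)].
  by apply/eqP; rewrite eq_le measure_ge0 andbT leNgt; apply/negP.
have [N [mN N0 hN]] := ess_sup_ge (leb2 R) (abse \o (EFin \o (f \_ D))).
exists N; split => // x [Dx Nx].
rewrite -lee_fin (fineK ffin) /Linfty_norm unlock T0.
apply: contrapT => h; apply: Nx; apply: hN => /=.
by rewrite patchE mem_set.
Qed.

Lemma Linfty_norm_le f (N : set (mplane R)) (C : R) :
    measurable N -> leb2 R N = 0%E -> 0 <= C ->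
    (forall x, (D `\` N) x -> `|f x| <= C) ->
  (Linfty_norm D f <= C%:E)%E.
Proof.
move=> mN N0 C0 h; rewrite /Linfty_norm unlock; case: ifPn => [T0|_]; last first.
  by rewrite lee_fin.
apply/ess_supP; exists N; split => // x /= hx; apply: contrapT => Nx; apply: hx.
rewrite patchE; case: ifPn => [/set_mem Dx|_]; rewrite lee_fin ?normr0//.
exact: h.
Qed.

Lemma Linfty_norm_seq_bound (f : nat -> plane R -> R) :
    (forall n, (Linfty_norm D (f n) < +oo)%E) ->
  exists N : set (mplane R), [/\ measurable N, leb2 R N = 0%E &
    forall n x, (D `\` N) x -> `|f n x| <= fine (Linfty_norm D (f n))].
Proof.
move=> fy; have /choice[N hN] := fun n => Linfty_norm_bound (fy n).
have mN : measurable (\bigcup_n N n).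
  by apply: bigcup_measurable => n _; case: (hN n).
exists (\bigcup_n N n); split => //.
  apply/negligibleP => //; apply: negligible_bigcup => n.
  by case: (hN n) => mn n0 _; apply/negligibleP.
move=> n x [Dx Nx]; have [_ _ h] := hN n; apply: h; split => // Nnx.
by apply: Nx; exists n.
Qed.

End essential_bound.

(** The Karhunen-Loeve data enter only through the products
    [Num.sqrt (lam m) * mu m], which are essentially bounded, whereas [mu m]
    alone need not be when [lam m] is 0. *)
Lemma nu_coef_scaled (R : realType) (M : nat) (mu0 : plane R -> R) (sigma : R)
    (lam : nat -> R) (mu : nat -> plane R -> R) (a : multi_index M) x :
    (forall m, 0 <= lam m) ->
  let s m := Num.sqrt (lam m) * mu m x in
  nu_coef mu0 sigma lam mu a x =
  expR (mu0 x + 2^-1 * sigma ^+ 2 * \sum_(m < M) s m ^+ 2) *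
  \prod_(m < M) ((sigma * s m) ^+ a m * (Num.sqrt ((a m)`!)%:R)^-1).
Proof.
move=> lam0 s; congr (expR (_ + _ * _) * _).
  by apply: eq_bigr => m _; rewrite exprMn sqr_sqrtr.
by apply: eq_bigr => m _; rewrite mulrA.
Qed.

Lemma bounded_measurable_nu_coef (R : realType) (E : set (mplane R)) (M : nat)
    (mu0 : plane R -> R) (sigma : R) (lam : nat -> R) (mu : nat -> plane R -> R)
    (a : multi_index M) :
    (forall m, 0 <= lam m) -> bounded_measurable E (mu0 : mplane R -> R) ->
    (forall m : 'I_M, bounded_measurable E
       (fun x : mplane R => Num.sqrt (lam m) * mu m x)) ->
  bounded_measurable E (nu_coef mu0 sigma lam mu a : mplane R -> R).
Proof.
move=> lam0 h0 hs.
rewrite (funext (fun x => nu_coef_scaled mu0 sigma mu a x lam0)).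
apply: bounded_measurableM.
  apply: bounded_measurable_expR; apply: bounded_measurableD => //.
  apply: bounded_measurableM; first exact: bounded_measurable_cst.
  by apply: bounded_measurable_sum => m; exact: bounded_measurableX.
apply: bounded_measurable_prod => m.
apply: bounded_measurableM; last exact: bounded_measurable_cst.
apply: bounded_measurableX; apply: bounded_measurableM => //.
exact: bounded_measurable_cst.
Qed.

Lemma in_Linfty_bounded_off_null (R : realType) (D : set (plane R))
    (f : nat -> plane R -> R) : measurable (D : set (mplane R)) ->
    (forall n, in_Linfty D (f n)) ->
  exists N : set (mplane R), [/\ measurable N, leb2 R N = 0%E &
    forall n, bounded_measurable (D `\` N : set (mplane R)) (f n)].
Proof.
move=> mD hf; have [|N [mN N0 hN]] := @Linfty_norm_seq_bound R D f.
  by move=> n; case: (hf n).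
exists N; split => // n; split; last first.
  by exists (fine (Linfty_norm D (f n))) => x Ex; exact: hN.
by apply: measurable_funS (hf n).1 => // x [].
Qed.

Lemma bounded_off_null_Linfty (R : realType) (D : set (plane R))
    (N : set (mplane R)) (f : plane R -> R) :
    measurable N -> leb2 R N = 0%E ->
    bounded_measurable (D `\` N : set (mplane R)) f ->
  (Linfty_norm D f < +oo)%E.
Proof.
move=> mN N0 [_ [C hC]].
apply: (@le_lt_trans _ _ (`|C|)%:E); last exact: ltry.
apply: (Linfty_norm_le mN N0) => // x Ex.
exact: le_trans (hC x Ex) (ler_norm _).
Qed.

(** * Stiffness matrices of the finite element space *)

Definition component (R : realType) (c : bool) (z : plane R) : R :=
  if c then z.1 else z.2.

Definition gradient_entry (R : realType) (u : plane R -> plane R)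
    (s : plane R * bool) (x : plane R) : R :=
  'D_(s.1) (fun z => component s.2 (u z) : R) x.

(** The four first-order derivatives of a vector field: a direction, and a flag
    that selects the component. *)
Definition gradient_index (R : realType) : seq (plane R * bool) :=
  [:: ((1, 0), true); ((1, 0), false); ((0, 1), true); ((0, 1), false)].

Lemma grad_dotE (R : realType) (u v : plane R -> plane R) (x : plane R) :
  grad_dot u v x = \sum_(s <- gradient_index R)
    gradient_entry u s x * gradient_entry v s x.
Proof.
by rewrite /grad_dot /gradient_index !big_cons !big_nil !addr0 !addrA.
Qed.

Lemma stiffness_mxE (R : realType) (D : set (plane R)) (N : set (mplane R))
    (Nu : nat)
    (phi : 'I_Nu -> plane R -> plane R) (nu : plane R -> R) :
    measurable N -> leb2 R N = 0%E ->
  stiffness_mx D phi nu = weighted_gram (leb2 R) (D `\` N : set (mplane R))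
    (gradient_index R) (fun i => gradient_entry (phi i)) nu.
Proof.
move=> mN N0; apply/matrixP => i j; rewrite !mxE /int_on.
rewrite (@Rintegral_setD_null _ _ R (leb2 R) D N _ mN N0).
by apply: eq_Rintegral => x _; rewrite grad_dotE.
Qed.

Lemma laplacian_mxE (R : realType) (D : set (plane R)) (Nu : nat)
    (phi : 'I_Nu -> plane R -> plane R) :
  laplacian_mx D phi = stiffness_mx D phi (fun=> 1).
Proof.
apply/matrixP => i j; rewrite !mxE; apply: eq_Rintegral => x _.
by rewrite mul1r.
Qed.

(** D lies in the union of the triangles, and a point of a triangle that is on
    none of its edge lines is in its interior, where the entry is affine. *)
Lemma gradient_entry_bounded_measurable (R : realType) (D : set (plane R)) h
    (T : seq (triangle R)) (E : set (mplane R)) (v : plane R -> plane R) s :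
    bounded_set D -> regular_triangulation D h T -> P2_space D T v ->
    measurable E -> E `<=` D ->
    (forall x K, K \in T -> E x -> ~ edge_lines K x) ->
  bounded_measurable E (gradient_entry v s : mplane R -> R).
Proof.
move=> bD [_ nd cl _ _] [_ _ hv] mE ED hE.
apply: (bounded_measurable_derive _ bD mE ED (T := T)) => [x Ex|K KT].
  have : closure D x by apply: subset_closure; exact: ED.
  rewrite cl => -[K KT Kx]; exists K => //.
  by apply: hull_interior => //; [exact: nd|exact: hE].
by have [h1 h2] := hv K KT; rewrite /component; case: s.2.
Qed.

(** * The Galerkin matrix and its preconditioner *)

(** Each term of the Galerkin matrix is bounded by the same block Laplacian, so
    the constants add up. *)
Lemma sgfe_upper (R : realType) (D : set (plane R)) (M k : nat)
    (alpha : nat -> multi_index M) (nu : nat -> plane R -> R) (nubar g : nat -> R)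
    (Nu : nat) (phi : 'I_Nu -> plane R -> plane R) (N : set (mplane R))
    (E := D `\` N : set (mplane R)) (v : 'cV[R]_(Qz M k * Nu)) :
    measurable N -> leb2 R N = 0%E -> measurable E -> (leb2 R E < +oo)%E ->
    (forall i s, bounded_measurable E (gradient_entry (phi i) s : mplane R -> R)) ->
    (forall q, bounded_measurable E (nu q : mplane R -> R)) ->
    (forall q, 0 <= nubar q) ->
    (forall q x, E x -> `|nu q x| <= nubar q) ->
    (forall q, (1 <= q < Qnu M k)%N -> forall a,
       `|quad (G_mx R k alpha q) a| <= g q * quad 1%:M a) ->
  quad (sgfe_mx k D alpha phi nu) v <=
  (nubar 0%N + \sum_(1 <= q < Qnu M k) g q * nubar q) *
  quad (1%:M *t laplacian_mx D phi) v.
Proof.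
move=> mN N0 mE Efin hphi hnu nubar0 nule hG.
rewrite laplacian_mxE /sgfe_mx quadDl quad_suml mulrDl mulr_suml lerD//.
  (* The term q = 0 is the case of the identity matrix, with g = 1. *)
  rewrite -[nubar 0%N]mul1r !(stiffness_mxE D phi _ mN N0).
  apply: quad_tens_weighted_gram_le => //; first exact: nule.
  by move=> a; rewrite mul1r ger0_norm// quad1_ge0.
rewrite big_seq [leRHS]big_seq; apply: ler_sum => q; rewrite mem_index_iota => hq.
rewrite !(stiffness_mxE D phi _ mN N0).
apply: quad_tens_weighted_gram_le => //; first exact: nule.
exact: hG.
Qed.

Theorem lemma1 (R : realType)
    (D : set (plane R)) (hD : bounded_domain D)
    (M k : nat) (hM : (0 < M)%N) (hk : (0 < k)%N)
    (sigma : R) (hsigma : 0 < sigma)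
    (d : measure_display) (Omega : measurableType d) (P : probability Omega R)
    (Z : plane R -> {RV P >-> R})
    (mu0 : plane R -> R) (lam : nat -> R) (mu : nat -> plane R -> R)
    (hKL : kl_eigenpairs D Z mu0 sigma lam mu)
    (hmu0 : in_Linfty D mu0)
    (hmu : forall m, in_Linfty D (fun x => Num.sqrt (lam m) * mu m x))
    (hl1 : (\sum_(0 <= m <oo)
              Linfty_norm D (fun x => Num.sqrt (lam m) * mu m x)%R < +oo)%E)
    (alpha : nat -> multi_index M) (halpha : chaos_enumeration k alpha)
    (hG : forall (q : nat) (a : 'cV[R]_(Qz M k)),
       (1 <= q < Qnu M k)%N -> a != 0 ->
       - g_coef R k (alpha q)
         <= quad (G_mx R k alpha q) a / (a^T *m a) 0 0
         <= g_coef R k (alpha q))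
    (delta Delta : R) (hdelta : 0 < delta) (hDelta : 0 < Delta)
    (h : R) (T : seq (triangle R)) (hT : regular_triangulation D h T)
    (Nu : nat) (phi : 'I_Nu -> plane R -> plane R) (hphi : P2_basis D T phi)
    (Amg : 'M[R]_Nu) (hAmg : spd Amg)
    (hequiv : forall v : 'cV[R]_Nu, v != 0 ->
       delta <= quad (laplacian_mx D phi) v / quad Amg v <= Delta) :
  let nu q := nu_coef mu0 sigma lam mu (alpha q) in
  let nubar q := fine (Linfty_norm D (nu q)) in
  let calA := sgfe_mx k D alpha phi nu in
  let calAmg : 'M[R]_(Qz M k * Nu) := 1%:M *t Amg in
  let nusigma := \sum_(1 <= q < Qnu M k) g_coef R k (alpha q) * nubar q in
  spd calA ->
  exists2 delta_low : R, 0 < delta_low &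
    forall v : 'cV[R]_(Qz M k * Nu), v != 0 ->
      delta_low <= quad calA v / quad calAmg v
                <= (nubar 0%N + nusigma) * Delta.
Proof.
move=> nu nubar calA calAmg nusigma hA.
have [[_ oD _ bD] [_ _ _ [hlam _ _ _]]] := (hD, hKL).
have lam0 m : 0 <= lam m by case: (hlam m).
have mD := open_measurable_plane oD.
have nubar0 q : 0 <= nubar q by apply: fine_ge0; exact: Linfty_norm_ge0.
have Amg_gt0 v : v != 0 -> 0 < quad calAmg v by exact: spd_tens1_gt0.
have [C C0 hC] := spd_dominates calAmg hA.
exists C^-1 => [|v v0]; first by rewrite invr_gt0.
rewrite ler_pdivlMr ?ler_pdivrMr ?Amg_gt0//; apply/andP; split.
  by rewrite ler_pdivrMl.
(* Four exceptional sets: N1 and N2 for the bounds on mu0 and on the scaled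
   eigenfunctions, N3 for the edges, N4 for the bounds on the nu_q by their
   norms.  The last needs finite norms, which come from N1 and N2. *)
have [N1 [mN1 N10 hN1]] := in_Linfty_bounded_off_null mD (fun _ : nat => hmu0).
have [N2 [mN2 N20 hN2]] := in_Linfty_bounded_off_null mD hmu.
have [N3 [mN3 N30 hN3]] : exists N : set (mplane R), [/\ measurable N,
    leb2 R N = 0%E & forall x K, K \in T -> ~ N x -> ~ edge_lines K x].
  by apply: all_edge_lines_null; case: hT.
have mN12 := measurableU _ _ mN1 mN2.
have N120 := null_set_setU mN1 mN2 N10 N20.
have hnu q : bounded_measurable (D `\` (N1 `|` N2) : set (mplane R)) (nu q).
  apply: bounded_measurable_nu_coef => //.
    apply: bounded_measurableS (hN1 0%N); first exact: measurableD.
    by move=> x [Dx Nx]; split => // ?; apply: Nx; left.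
  move=> m; apply: bounded_measurableS (hN2 m); first exact: measurableD.
  by move=> x [Dx Nx]; split => // ?; apply: Nx; right.
have [|N4 [mN4 N40 hN4]] := @Linfty_norm_seq_bound R D nu.
  by move=> q; exact: bounded_off_null_Linfty (hnu q).
pose N := (N1 `|` N2) `|` (N3 `|` N4).
have mN34 := measurableU _ _ mN3 mN4.
have mN : measurable N by exact: measurableU.
have N0 : leb2 R N = 0%E.
  by apply: null_set_setU => //; exact: null_set_setU.
have mE : measurable (D `\` N : set (mplane R)) by exact: measurableD.
have Efin : (leb2 R (D `\` N : set (mplane R)) < +oo)%E.
  apply: le_lt_trans (bounded_finite_measure bD mD).
  by apply: le_measure; rewrite ?inE// => x [].
have Lap_le (w : 'cV[R]_Nu) : quad (laplacian_mx D phi) w <= Delta * quad Amg w.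
  have [->|w0] := eqVneq w 0; first by rewrite !quad0v mulr0.
  by have /andP[_] := hequiv w w0; rewrite ler_pdivrMr//; case: hAmg => _; apply.
have nus0 : 0 <= nubar 0%N + nusigma.
  by rewrite addr_ge0// sumr_ge0// => q _; rewrite mulr_ge0// expR_ge0.
apply: (@le_trans _ _ ((nubar 0%N + nusigma) *
    quad (1%:M *t laplacian_mx D phi) v)); last first.
  by rewrite -mulrA ler_wpM2l// quad_tens1_le.
apply: (sgfe_upper v mN N0) => //.
- move=> i s; have [hP _] := hphi.
  apply: (gradient_entry_bounded_measurable s bD hT (hP i)) => //.
  move=> x K KT [_ Nx]; apply: hN3 => // N3x; apply: Nx; right; left; exact: N3x.
- move=> q; apply: bounded_measurableS (hnu q); first exact: measurableD.
  by move=> x [Dx Nx]; split => // Nx'; apply: Nx; left.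
- move=> q x [Dx Nx]; apply: hN4; split => // Nx'; apply: Nx; right; right.
  exact: Nx'.
- by move=> q hq; apply: ratio_bounds_norm => a a0; exact: hG.
Qed.
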